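(* Let $q$ be a power of two, $A$ a $q$-modular witness in a graph $G$, $d$ a lift modulo $2q$ of the common residue modulo $q$ of the degrees $\deg_A(v)$, and $b_A:A\to\mathbb F_2$ defined by $\deg_A(v)\equiv d+qb_A(v)\pmod{2q}$. Let $U\subseteq A$ and suppose $D=A\setminus U$ is partitioned into blocks $P_1,\dots,P_t$, each of size $q$, all vertices of $P_i$ having the same trace $B_i=N(x)\cap U$ on $U$. For $I\subseteq\{1,\dots,t\}$ put $E_I=\bigcup_{i\in I}P_i$ and $W_I=A\setminus E_I$. Then the degrees $\deg_{W_I}(u)$, $u\in U$, are all congruent modulo $2q$ if and only if $[b_A|_U]=\sum_{i\in I}[\mathbf 1_{B_i}]$ in $\mathbb F_2^U/\langle\mathbf 1_U\rangle$. Consequently, some subcollection $I$ achieves this if and only if $[b_A|_U]\in\operatorname{Span}\{[\mathbf 1_{B_1}],\dots,[\mathbf 1_{B_t}]\}$. For $I=\{1,\dots,t\}$ (so $W_I=U$), $U$ is $2q$-modular if and only if $[b_A|_U]=\sum_{i=1}^t[\mathbf 1_{B_i}]$.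
   Context: Graphs are finite simple; $\deg_S(v)$ is the degree of $v$ in $G[S]$; $S$ is $q$-modular if all $\deg_S(v)$, $v\in S$, are congruent modulo $q$. $\mathbf 1_B\in\mathbb F_2^U$ is the indicator of $B$; quotient by constants. *)

(* Defs.v *)
From HB Require Import structures.
From mathcomp Require Import all_boot all_order all_algebra.
From mathcomp Require Import ring_quotient.

Set Implicit Arguments.
Unset Strict Implicit.
Unset Printing Implicit Defensive.

Import GRing.Theory VectorInternalTheory.
Local Open Scope ring_scope.

(* The quotient space V / W carries the additive structure of                *)
(* [Quotient.quot]; we add the scaling and the finite-dimensionality, so that *)
(* the library's spans apply to it.                                           *)
Section QuotientSpace.
Local Open Scope quotient_scope.
Variables (K : fieldType) (V : vectType K) (W : {vspace V}).

Definition quotv := Quotient.quot W.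

HB.instance Definition _ := GRing.Zmodule.on quotv.

Definition qclass (v : V) : quotv := \pi_(Quotient.quot W) v.

Definition qscale (a : K) (x : quotv) : quotv :=
  qclass (a *: repr (x : Quotient.quot W)).

Lemma qclass_eq (u v : V) : (qclass u == qclass v) = (u - v \in W).
Proof. by rewrite Quotient.idealrBE. Qed.

Lemma qclassD (u v : V) : qclass (u + v) = qclass u + qclass v.
Proof. by rewrite /qclass raddfD. Qed.

Lemma qclass_surj (x : quotv) : exists v, x = qclass v.
Proof. by exists (repr (x : Quotient.quot W)); rewrite /qclass reprK. Qed.

Lemma qclassZ (a : K) (v : V) : qclass (a *: v) = qscale a (qclass v).
Proof.
apply/eqP; rewrite /qscale qclass_eq -scalerBr memvZ //.
by rewrite -qclass_eq {2}/qclass reprK.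
Qed.

Fact qscaleA a b x : qscale a (qscale b x) = qscale (a * b) x.
Proof. by case: (qclass_surj x) => v ->; rewrite -!qclassZ scalerA. Qed.

Fact qscale1 : left_id 1 qscale.
Proof. by move=> x; case: (qclass_surj x) => v ->; rewrite -qclassZ scale1r. Qed.

Fact qscaleDr : right_distributive qscale +%R.
Proof.
move=> a x y; case: (qclass_surj x) (qclass_surj y) => u -> [v ->].
by rewrite -qclassD -!qclassZ -qclassD scalerDr.
Qed.

Fact qscaleDl x : {morph qscale^~ x : a b / a + b}.
Proof.
move=> a b; case: (qclass_surj x) => v ->.
by rewrite -!qclassZ -qclassD scalerDl.
Qed.

HB.instance Definition _ :=
  GRing.Zmodule_isLmodule.Build K quotv qscaleA qscale1 qscaleDr qscaleDl.

Fact qclass_is_linear : linear qclass.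
Proof. by move=> a u v; rewrite qclassD qclassZ. Qed.

HB.instance Definition _ :=
  GRing.isLinear.Build K V quotv *:%R qclass qclass_is_linear.

Definition compl_part (v : V) : V := v - projv W v.

Fact compl_part_is_linear : linear compl_part.
Proof.
by move=> a u v; rewrite /compl_part linearP scalerBr opprD addrACA.
Qed.

HB.instance Definition _ :=
  GRing.isLinear.Build K V V *:%R compl_part compl_part_is_linear.

Lemma compl_part_eq0 v : (compl_part v == 0) = (v \in W).
Proof.
rewrite subr_eq0; apply/eqP/idP => [->|/projv_id-> //].
exact: memv_proj.
Qed.

Lemma compl_part_id v : v \in (W^C)%VS -> compl_part v = v.
Proof. by rewrite -lker_proj memv_ker /compl_part => /eqP->; rewrite subr0. Qed.

Lemma compl_part_eq u v : (qclass u == qclass v) = (compl_part u == compl_part v).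
Proof. by rewrite qclass_eq -compl_part_eq0 linearB subr_eq0. Qed.

Definition qcompl (x : quotv) : subvs_of W^C :=
  vsproj W^C (compl_part (repr (x : Quotient.quot W))).

Lemma qcomplE v : qcompl (qclass v) = vsproj W^C (compl_part v).
Proof.
congr (vsproj _ _); apply/eqP.
by rewrite -compl_part_eq {1}/qclass reprK.
Qed.

Fact quotv_vect_iso : Vector.axiom (dim (subvs_of W^C)) quotv.
Proof.
exists (fun x => v2r (qcompl x)).
  move=> a x y; case: (qclass_surj x) (qclass_surj y) => u -> [v ->].
  by rewrite -qclass_is_linear !qcomplE !linearP.
exists (fun r => qclass (vsval (r2v r : subvs_of W^C))) => [x|r].
  case: (qclass_surj x) => v ->; rewrite v2rK qcomplE.
  have mv : compl_part v \in (W^C)%VS by exact: memv_projC.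
  by apply/eqP; rewrite vsprojK // compl_part_eq compl_part_id.
by rewrite qcomplE compl_part_id ?subvsP // vsvalK r2vK.
Qed.

HB.instance Definition _ := Lmodule_hasFinDim.Build K quotv quotv_vect_iso.

End QuotientSpace.

Arguments qclass {K V} W v.

(* A simple graph on the vertex set T is an adjacency relation e : rel T that *)
(* is symmetric and irreflexive.                                              *)
Section Degrees.
Variables (T : finType) (e : rel T).

Definition nbhd (x : T) : {set T} := [set y | e x y].

(* For v in S this is the degree of v in the induced subgraph G[S].           *)
Definition deg (S : {set T}) (v : T) : nat := #|nbhd v :&: S|.

Definition modular (q : nat) (S : {set T}) : Prop :=
  {in S &, forall u v, deg S u = deg S v %[mod q]}.

End Degrees.

Section FunctionsModConstants.
Variable T : finType.

(* The regular module ('F_2)^o gives this type its vector space structure.      *)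
Definition F2fun (U : {set T}) : Type := {ffun {x : T | x \in U} -> ('F_2)^o}.

HB.instance Definition _ (U : {set T}) := Vector.on (F2fun U).

Definition indic (U B : {set T}) : F2fun U := [ffun u => (val u \in B)%:R].

Definition restrict (U A : {set T}) (sUA : U \subset A)
    (b : {x : T | x \in A} -> 'F_2) : F2fun U :=
  [ffun u => b (exist _ (val u) (subsetP sUA (val u) (valP u)))].

Definition modconst (U : {set T}) (f : F2fun U) : quotv <[indic U U]>%VS :=
  qclass <[indic U U]>%VS f.

End FunctionsModConstants.

(* Main.v *)
(* By symmetry a vertex u of U is adjacent to all q vertices of P_i if u lies
   in B_i and to none otherwise. Deleting the blocks of I thus lowers the degree
   of u by q c(u), where c(u) is the number of i in I with u in B_i, and the new
   degree is d + q (b(u) - c(u)) modulo 2q. These residues agree on U iff b - c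
   is constant modulo 2. Over F_2, a span consists of the subset sums. *)
Require Import Defs.
From mathcomp Require Import all_boot all_order all_algebra.

Set Implicit Arguments.
Unset Strict Implicit.
Unset Printing Implicit Defensive.

Import GRing.Theory.
Local Open Scope ring_scope.

Lemma natr_F2_eq (m n : nat) : (m%:R == n%:R :> 'F_2) = (m == n %[mod 2]).
Proof. by rewrite -val_eqE /= !val_Fp_nat. Qed.

Lemma mem_span_image (K : fieldType) (V : vectType K) (J : finType)
    (F : J -> V) (v : V) :
  reflect (exists c : J -> K, v = \sum_j c j *: F j)
          (v \in <<[seq F j | j : J]>>%VS).
Proof.
rewrite span_def big_image; apply: (iffP memv_sumP) => [[w wF ->]|[c ->]].
  (* The span is a sum of lines, so each summand has a coefficient, which [xchoose] then selects. *)
  have wF' j : exists a, w j == a *: F j.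
    by have /vlineP[a ->] := wF j isT; exists a.
  by exists (fun j => xchoose (wF' j)); apply: eq_bigr => j _;
    apply/eqP/(xchooseP (wF' j)).
by exists (fun j => c j *: F j) => // j _; rewrite memvZ ?memv_line.
Qed.

Lemma mem_span_image_F2 (V : vectType 'F_2) (J : finType) (F : J -> V) (v : V) :
  v \in <<[seq F j | j : J]>>%VS <-> exists I : {set J}, v = \sum_(j in I) F j.
Proof.
split=> [/mem_span_image[c ->]|[I ->]]; last first.
  by apply: memv_suml => j _; apply/memv_span/image_f.
(* The subset is the support of the coefficients: over F_2 a nonzero coefficient is 1. *)
exists [set j | c j != 0]; rewrite [RHS]big_mkcond; apply: eq_bigr => j _.
rewrite inE; case: (c j) => [[|[|m]] cj] //.
  by rewrite (_ : Ordinal _ = 0) ?scale0r ?eqxx //; apply: val_inj.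
by rewrite (_ : Ordinal _ = 1) ?scale1r //; apply: val_inj.
Qed.

Section FunctionsModConstants.
Variables (T : finType) (U : {set T}).

(** Both sides say that [f - g] is constant. Without subtraction, the condition can later be read as
    a congruence of natural numbers modulo 2. *)
Lemma modconst_eqP (f g : F2fun U) :
  modconst f = modconst g <-> forall u v, f u + g v = f v + g u.
Proof.
split=> [/eqP|fg].
  rewrite qclass_eq => /vlineP[a fgE] u v.
  have fE w : f w = a + g w.
    have := congr1 (fun h : F2fun U => h w) fgE.
    rewrite !ffunE (valP w) => /eqP; rewrite subr_eq => /eqP->.
    by rewrite [_ *: _]mulr1.
  by rewrite !fE addrAC.
apply/eqP; rewrite qclass_eq; apply/vlineP.
(* Any point [v] of [U] provides the constant [f v - g v]. If [U] is empty, all functions on it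
   coincide and 0 serves. *)
case: (pickP {: {x : T | x \in U}}) => [v _|U0].
  exists (f v - g v); apply/ffunP => u; rewrite !ffunE (valP u).
  rewrite [RHS]mulr1; apply/eqP.
  by rewrite subr_eq addrAC -fg addrK.
by exists 0; apply/ffunP => u; have := U0 u.
Qed.

Lemma modconst_sum (J : finType) (I : {pred J}) (F : J -> F2fun U) :
  \sum_(j in I) modconst (F j) = modconst (\sum_(j in I) F j).
Proof. by rewrite /modconst raddf_sum. Qed.

Lemma sum_indicE (J : finType) (I : {pred J}) (B : J -> {set T}) u :
  (\sum_(j in I) indic U (B j)) u = (\sum_(j in I) (val u \in B j))%:R.
Proof.
rewrite sum_ffunE natr_sum; apply: eq_bigr => j _.
by rewrite ffunE.
Qed.

End FunctionsModConstants.

Section BlockDeletion.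
Variables (T : finType) (e : rel T).

Lemma degE (S : {set T}) v : deg e S v = (\sum_(x in S) e v x)%N.
Proof.
rewrite /deg -sum1_card (eq_bigl (fun x => (x \in S) && e v x)) => [|x].
  by rewrite big_mkcondr; apply: eq_bigr => x _; case: (e v x).
by rewrite !inE andbC.
Qed.

Hypothesis e_sym : symmetric e.
Variables (q : nat) (A U : {set T}) (J : finType) (P B : J -> {set T}).
Hypotheses (P_inj : injective P) (P_card : forall j, #|P j| = q).
Hypothesis P_part : partition [set P j | j : J] (A :\: U).
Hypothesis B_trace : forall j, {in P j, forall x, nbhd e x :&: U = B j}.

Lemma deg_block j u : u \in U -> deg e (P j) u = (q * (u \in B j))%N.
Proof.
move=> uU; rewrite degE -(P_card j) -sum_nat_const; apply: eq_bigr => x xP.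
by rewrite -(B_trace xP) !inE uU andbT e_sym.
Qed.

(** Degree is additive over disjoint sets, here the deleted blocks and the rest of [A]. The sum form
    avoids truncated subtraction. *)
Lemma deg_delete_blocks (I : {set J}) u : u \in U ->
  (deg e (A :\: \bigcup_(j in I) P j) u + q * \sum_(j in I) (u \in B j))%N
    = deg e A u.
Proof.
move=> uU; have /and3P[/eqP covP trivP _] := P_part.
have sPA : \bigcup_(j in I) P j \subset A.
  apply/bigcupsP => j _; apply: (subset_trans _ (subsetDl A U)).
  by rewrite -covP /cover (bigcup_max (P j)) // imset_f.
rewrite [RHS]degE (big_setID (\bigcup_(j in I) P j)) /= (setIidPr sPA) addnC.
(* The deleted set is the cover of a subfamily of the partition. Disjointness splits the sum by
   blocks, and injectivity of [P] reindexes it by [I]. *)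
rewrite -!degE; congr (_ + _)%N; rewrite degE -cover_imset big_trivIset /=.
  rewrite big_imset /= => [|i j _ _]; last exact: P_inj.
  by rewrite big_distrr; apply: eq_bigr => j _; rewrite -degE deg_block.
exact: trivIsetS (imsetS _ (subset_predT (mem I))) trivP.
Qed.

Lemma delete_all_blocks : U \subset A -> A :\: \bigcup_(j in [set: J]) P j = U.
Proof.
move=> sUA; have /and3P[/eqP covP _ _] := P_part.
rewrite -cover_imset (_ : P @: [set: J] = [set P j | j : J]).
  by rewrite covP setDDr setDv set0U (setIidPr sUA).
by apply/setP => S; apply/imsetP/imsetP => -[j _ ->]; exists j.
Qed.

End BlockDeletion.

(* With the subtractions cleared, this compares [d + q (b - c)] and
   [d + q (b' - c')] modulo [2 q]. *)
Lemma eqn_mod_double (q d x y b b' c c' : nat) : (0 < q)%N ->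
  (x + q * c = d + q * b %[mod 2 * q])%N ->
  (y + q * c' = d + q * b' %[mod 2 * q])%N ->
  (x == y %[mod 2 * q])%N = (b + c' == b' + c %[mod 2])%N.
Proof.
move=> q0 xE yE.
(* Scaling by the positive [q] turns a congruence modulo 2 into one modulo [2 * q]. *)
have -> : (b + c' == b' + c %[mod 2])%N =
          (q * (b + c') == q * (b' + c) %[mod 2 * q])%N.
  by rewrite [(2 * q)%N]mulnC -!muln_modr eqn_pmul2l.
(* Adding [q * c + q * c'] to both sides lets each hypothesis replace its degree; [d] then
   cancels. *)
rewrite -(eqn_modDr (q * c + q * c')) addnA -modnDml xE modnDml.
rewrite [(q * c + _)%N]addnC addnA -[in X in _ == X]modnDml yE modnDml.
by rewrite -!addnA -!mulnDr eqn_modDl.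
Qed.

Theorem mainTheorem15
    (T : finType) (e : rel T) (e_sym : symmetric e) (e_irr : irreflexive e)
    (k q : nat) (q_def : q = (2 ^ k)%N)
    (A : {set T}) (A_mod : modular e q A)
    (d : nat) (d_lift : {in A, forall v, deg e A v = d %[mod q]})
    (b : {x : T | x \in A} -> 'F_2)
    (b_def : forall v : {x : T | x \in A},
       deg e A (val v) = (d + q * nat_of_ord (b v))%N %[mod 2 * q])
    (U : {set T}) (sUA : U \subset A)
    (t : nat) (P : 'I_t -> {set T})
    (P_inj : injective P)
    (P_part : partition [set P i | i : 'I_t] (A :\: U))
    (P_card : forall i, #|P i| = q)
    (B : 'I_t -> {set T})
    (B_trace : forall i, {in P i, forall x, nbhd e x :&: U = B i}) :
  let W (I : {set 'I_t}) := A :\: \bigcup_(i in I) P i in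
  let congruent_on_U (I : {set 'I_t}) :=
    {in U &, forall u v, deg e (W I) u = deg e (W I) v %[mod 2 * q]} in
  [/\ forall I : {set 'I_t},
        congruent_on_U I <->
        modconst (restrict sUA b) = \sum_(i in I) modconst (indic U (B i)),
      (exists I : {set 'I_t}, congruent_on_U I) <->
        modconst (restrict sUA b)
          \in <<[seq modconst (indic U (B i)) | i : 'I_t]>>%VS,
      W [set: 'I_t] = U
    & modular e (2 * q) U <->
        modconst (restrict sUA b) = \sum_(i < t) modconst (indic U (B i))].
Proof.
move=> W congruent_on_U.
have q0 : (0 < q)%N by rewrite q_def expn_gt0.
have main I : congruent_on_U I <->
    modconst (restrict sUA b) = \sum_(i in I) modconst (indic U (B i)).
  pose c (u : T) := (\sum_(i in I) (u \in B i))%N.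
  have degW (u : {x : T | x \in U}) :
      (deg e (W I) (val u) + q * c (val u)
         = d + q * restrict sUA b u %[mod 2 * q])%N.
    rewrite (deg_delete_blocks e_sym P_inj P_card P_part B_trace) ?(valP u) //.
    by rewrite ffunE; exact: b_def (exist _ (val u) _).
  (* Writing elements of F_2 as casts of their representatives turns equations in F_2 into
     congruences modulo 2. *)
  have natF2 (a : 'F_2) : a = (nat_of_ord a)%:R by rewrite natr_Zp.
  rewrite modconst_sum; apply: iff_trans (iff_sym (modconst_eqP _ _)).
  split=> [congU u v|eqU u v uU vU].
    rewrite !sum_indicE [restrict sUA b u]natF2 [restrict sUA b v]natF2.
    rewrite -!natrD; apply/eqP; rewrite natr_F2_eq -(eqn_mod_double q0 (degW u) (degW v)).
    by apply/eqP; exact: congU (valP u) (valP v).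
  pose u' : {x : T | x \in U} := exist _ u uU.
  pose v' : {x : T | x \in U} := exist _ v vU.
  apply/eqP; rewrite (eqn_mod_double q0 (degW u') (degW v')).
  rewrite -natr_F2_eq !natrD -!natF2.
  by have := eqU u' v'; rewrite !sum_indicE => ->.
have WT : W [set: 'I_t] = U by apply: delete_all_blocks.
split=> //.
  by split=> [[I /main bI]|/mem_span_image_F2[I /main]];
    [apply/mem_span_image_F2|]; exists I.
have := main [set: 'I_t]; rewrite /congruent_on_U WT.
by under eq_bigl do rewrite inE.
Qed.
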